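(* Let $A\in\mathbb{R}^{n\times n}$ be a nonsingular matrix and $\nu=\|A^{-1}\|_2$. Let $\tau\in\mathbb{R}$. If $$0<\nu<1\quad\text{and}\quad 0<\tau<\frac{2}{\nu+1},$$ then for any $b\in\mathbb{R}^n$ the absolute value equation $Ax-|x|=b$ has a unique solution $x_*\in\mathbb{R}^n$, and the sequence $\{(x^{(k)},y^{(k)})\}_{k=0}^\infty$ generated by the fixed point iteration $$\begin{cases} x^{(k+1)}=A^{-1}(y^{(k)}+b),\\ y^{(k+1)}=(1-\tau)y^{(k)}+\tau|x^{(k+1)}|,\end{cases}\qquad k=0,1,2,\ldots$$ converges globally linearly to $(x_*,y_* )$ with $y_*=|x_*|$.
   Context: For a vector $x\in\mathbb{R}^n$, $|x|\in\mathbb{R}^n$ denotes the entrywise absolute value. $\|\cdot\|_2$ denotes the Euclidean norm of vectors and the induced operator norm (spectral norm) of matrices. ''Globally'' means for arbitrary initial vectors $x^{(0)},y^{(0)}\in\mathbb{R}^n$. ''Linearly'' means that the errors decay at least geometrically: for each choice of initial vectors there are constants $C\ge 0$ and $q\in(0,1)$ such that $\|x^{(k)}-x_*\|_2\le Cq^k$ and $\|y^{(k)}-y_*\|_2\le Cq^k$ for all $k\ge 0$. *)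

(* Defs.v *)
From mathcomp Require Import all_boot all_order all_algebra.
From mathcomp Require Import classical_sets reals.
Set Implicit Arguments.
Unset Strict Implicit.
Unset Printing Implicit Defensive.
Import Order.TTheory GRing.Theory Num.Theory.
Local Open Scope classical_set_scope.
Local Open Scope ring_scope.

(* MathComp-Analysis' norm on matrices is the max norm, hence this one. *)
Definition norm2 (R : realType) (n : nat) (x : 'cV[R]_n) : R :=
  Num.sqrt (\sum_(i < n) x i 0 ^+ 2).

(* The supremum is over the closed unit ball, which is nonempty even for n = 0. *)
Definition opnorm2 (R : realType) (m n : nat) (M : 'M[R]_(m, n)) : R :=
  sup [set norm2 (M *m x) | x in [set x : 'cV[R]_n | norm2 x <= 1]].

Definition vabs (R : realType) (n : nat) (x : 'cV[R]_n) : 'cV[R]_n :=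
  \col_(i < n) `|x i 0|.

Definition ave_solution (R : realType) (n : nat) (A : 'M[R]_n) (b x : 'cV[R]_n)
  : Prop := A *m x - vabs x = b.

Definition fpi_step (R : realType) (n : nat) (A : 'M[R]_n) (b : 'cV[R]_n)
    (tau : R) (p : 'cV[R]_n * 'cV[R]_n) : 'cV[R]_n * 'cV[R]_n :=
  let x' := invmx A *m (p.2 + b) in
  (x', (1 - tau) *: p.2 + tau *: vabs x').

Definition fpi (R : realType) (n : nat) (A : 'M[R]_n) (b : 'cV[R]_n) (tau : R)
    (x0 y0 : 'cV[R]_n) (k : nat) : 'cV[R]_n * 'cV[R]_n :=
  iter k (fpi_step A b tau) (x0, y0).

Definition converges_linearly (R : realType) (n : nat)
    (s : nat -> 'cV[R]_n * 'cV[R]_n) (x y : 'cV[R]_n) : Prop :=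
  exists C q : R,
    [/\ 0 <= C, 0 < q < 1 &
        forall k : nat, norm2 ((s k).1 - x) <= C * q ^+ k /\
                        norm2 ((s k).2 - y) <= C * q ^+ k].

(* Main.v *)
Require Import Defs.
From mathcomp Require Import all_boot all_order all_algebra.
From mathcomp Require Import ring lra.
From mathcomp Require Import classical_sets reals.
Import Order.TTheory GRing.Theory Num.Theory.
Local Open Scope ring_scope.

(** The first component of each iterate is a function of the previous second
component, so the dynamics is that of a single map on the y-variable,
[fpi_map]: y |-> (1 - tau) y + tau |A^-1 (y + b)|.  Since the entrywise
absolute value is 1-Lipschitz for the Euclidean norm, this map is Lipschitz
with constant q = |1 - tau| + tau nu ([fpi_map_contraction]).  When tau <= 1
this is 1 - tau (1 - nu), and when tau > 1 it is tau (1 + nu) - 1; the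
hypotheses on nu and tau are exactly what makes both smaller than 1
([relaxed_rate_lt1]).

Hence the map has exactly one fixed point ys ([contraction_fixpoint_exists],
[contraction_fixpoint_unique]).  Its fixed points do not depend on tau: they
are the y with |A^-1 (y + b)| = y ([fpi_map_fixpointE]), and x |-> |x| and
y |-> A^-1 (y + b) are inverse bijections between the solutions of
A x - |x| = b and these fixed points ([ave_solutionE]).  This gives existence
and uniqueness of the solution; the iterates of the contraction approach ys at
the rate q, and A^-1 transports that rate to the first components.

Completeness enters through suprema of sets of reals, one coordinate at a
time: a sequence with geometrically decaying increments is squeezed between
an increasing and a decreasing sequence ([geometric_increments_limit]). *)

(** * The Euclidean norm and the operator norm *)

Section Norm2.
Context {R : realType}.

Lemma norm2_ge0 n (x : 'cV[R]_n) : 0 <= norm2 x.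
Proof. exact: sqrtr_ge0. Qed.

Lemma sqr_norm2 n (x : 'cV[R]_n) : norm2 x ^+ 2 = \sum_(i < n) x i 0 ^+ 2.
Proof. by rewrite sqr_sqrtr // sumr_ge0 // => i _; exact: sqr_ge0. Qed.

Lemma norm2_leE n (x : 'cV[R]_n) (a : R) :
  0 <= a -> (norm2 x <= a) = (\sum_(i < n) x i 0 ^+ 2 <= a ^+ 2).
Proof. by move=> a0; rewrite -sqr_norm2 ler_sqr ?nnegrE ?norm2_ge0. Qed.

Lemma norm2_0 n : norm2 (0 : 'cV[R]_n) = 0.
Proof. by rewrite /norm2 big1 ?sqrtr0 // => i _; rewrite mxE expr0n. Qed.

Lemma le_norm2 n (x y : 'cV[R]_n) :
  (forall i, `|x i 0| <= `|y i 0|) -> norm2 x <= norm2 y.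
Proof.
move=> xy; rewrite norm2_leE ?norm2_ge0// sqr_norm2; apply: ler_sum => i _.
by rewrite -(real_normK (num_real (x i 0))) -(real_normK (num_real (y i 0)))
  ler_sqr ?nnegrE.
Qed.

Lemma norm_coord_le_norm2 n (x : 'cV[R]_n) i : `|x i 0| <= norm2 x.
Proof.
rewrite -ler_sqr ?nnegrE ?norm2_ge0// sqr_norm2 real_normK ?num_real//.
by rewrite (bigD1 i)//= lerDl sumr_ge0// => j _; exact: sqr_ge0.
Qed.

Lemma norm2_le0_eq0 n (x : 'cV[R]_n) : norm2 x <= 0 -> x = 0.
Proof.
move=> x0; apply/colP => i; rewrite mxE; apply/eqP.
by rewrite -normr_le0 (le_trans (norm_coord_le_norm2 n x i)).
Qed.

Lemma norm2Z n (a : R) (x : 'cV[R]_n) : norm2 (a *: x) = `|a| * norm2 x.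
Proof.
rewrite /norm2 -sqrtr_sqr -sqrtrM ?sqr_ge0// mulr_sumr.
by congr Num.sqrt; apply: eq_bigr => i _; rewrite mxE exprMn.
Qed.

Lemma norm2_dist n (x y : 'cV[R]_n) : norm2 (x - y) = norm2 (y - x).
Proof. by rewrite -opprB -scaleN1r norm2Z normrN1 mul1r. Qed.

(** Convexity of the square, at the weights s / (s + t) and t / (s + t) and the
points a / s and b / t.  Summed over coordinates with s and t the norms of the
two vectors, it yields the triangle inequality without Cauchy-Schwarz. *)
Lemma sqrrD_le_weighted (s t a b : R) : 0 < s -> 0 < t ->
  (a + b) ^+ 2 <= (s + t) * (a ^+ 2 / s + b ^+ 2 / t).
Proof.
move=> s0 t0; rewrite -subr_ge0.
have -> : (s + t) * (a ^+ 2 / s + b ^+ 2 / t) - (a + b) ^+ 2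
        = (t * a - s * b) ^+ 2 / (s * t).
  by field; rewrite !gt_eqF.
by rewrite divr_ge0 ?sqr_ge0// mulr_ge0// ltW.
Qed.

Lemma norm2D n (x y : 'cV[R]_n) : norm2 (x + y) <= norm2 x + norm2 y.
Proof.
have [x0|x0] := leP (norm2 x) 0.
  by rewrite (norm2_le0_eq0 _ _ x0) add0r norm2_0 add0r.
have [y0|y0] := leP (norm2 y) 0.
  by rewrite (norm2_le0_eq0 _ _ y0) addr0 norm2_0 addr0.
rewrite norm2_leE ?addr_ge0 ?norm2_ge0//.
apply: (@le_trans _ _ (\sum_(i < n) (norm2 x + norm2 y) *
    (x i 0 ^+ 2 / norm2 x + y i 0 ^+ 2 / norm2 y))).
  by apply: ler_sum => i _; rewrite mxE sqrrD_le_weighted.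
rewrite -mulr_sumr big_split/= -!mulr_suml -!sqr_norm2.
by rewrite !expr2 !mulfK ?gt_eqF.
Qed.

Lemma norm2_le_sum n (x : 'cV[R]_n) : norm2 x <= \sum_(i < n) `|x i 0|.
Proof.
rewrite norm2_leE ?sumr_ge0// [leRHS]expr2 mulr_suml; apply: ler_sum => i _.
rewrite -real_normK ?num_real// expr2 ler_wpM2l//.
by rewrite (bigD1 i)//= lerDl sumr_ge0.
Qed.

Lemma norm2_le_card n (x : 'cV[R]_n) (e : R) :
  (forall i, `|x i 0| <= e) -> norm2 x <= n%:R * e.
Proof.
move=> xe; apply: le_trans (norm2_le_sum n x) _.
by apply: le_trans (ler_sum _ (fun i _ => xe i)) _; rewrite sumr_const card_ord mulr_natl.
Qed.

Lemma norm2_vabs_dist n (x y : 'cV[R]_n) :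
  norm2 (vabs x - vabs y) <= norm2 (x - y).
Proof. by apply: le_norm2 => i; rewrite !mxE ler_dist_dist. Qed.

(** A crude bound; it ensures that the supremum defining the operator norm is
that of a bounded set, hence a genuine upper bound. *)
Lemma norm2_mulmx_le_sum m n (M : 'M[R]_(m, n)) (x : 'cV[R]_n) :
  norm2 x <= 1 -> norm2 (M *m x) <= \sum_(i < m) \sum_(j < n) `|M i j|.
Proof.
move=> x1; apply: le_trans (norm2_le_sum m _) _; apply: ler_sum => i _.
rewrite mxE; apply: le_trans (ler_norm_sum _ _ _) _; apply: ler_sum => j _.
rewrite normrM ler_piMr//; exact: le_trans (norm_coord_le_norm2 n x j) x1.
Qed.

Lemma norm2_mulmx_le_opnorm2 m n (M : 'M[R]_(m, n)) (x : 'cV[R]_n) :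
  norm2 (M *m x) <= opnorm2 M * norm2 x.
Proof.
have [x0|x0] := leP (norm2 x) 0.
  by rewrite (norm2_le0_eq0 _ _ x0) mulmx0 !norm2_0 mulr0.
have nx : `|(norm2 x)^-1| = (norm2 x)^-1 by rewrite ger0_norm ?invr_ge0 ?norm2_ge0.
rewrite -ler_pdivrMr// mulrC -nx -norm2Z scalemxAr /opnorm2; apply: ub_le_sup.
  by exists (\sum_(i < m) \sum_(j < n) `|M i j|) => _ [z z1 <-];
     exact: norm2_mulmx_le_sum.
exists ((norm2 x)^-1 *: x) => //=.
by rewrite norm2Z nx mulVf ?gt_eqF.
Qed.

End Norm2.

(** * Real sequences with geometric bounds *)

Section Geometric.
Context {R : realType}.

(** The increments are bounded by the decrements of c q^k, so u k - c q^k is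
nondecreasing and u k + c q^k is nonincreasing.  Every term of the first
sequence is below every term of the second, and the supremum of the first lies
between the two at every index, which is the stated error bound. *)
Lemma geometric_increments_limit (u : nat -> R) (c q : R) :
  (forall k, `|u k.+1 - u k| <= c * (1 - q) * q ^+ k) ->
  0 <= c -> 0 <= q ->
  exists l, forall k, `|u k - l| <= c * q ^+ k.
Proof.
move=> du c0 q0.
pose lo k := u k - c * q ^+ k; pose up k := u k + c * q ^+ k.
have E k : c * (1 - q) * q ^+ k = c * q ^+ k - c * q ^+ k.+1 by rewrite exprS; ring.
have lo_homo : {homo lo : i j / (i <= j)%N >-> i <= j}.
  apply: homo_leq => [|? ? ?|k]; [exact: lexx|exact: le_trans|].
  by have := du k; rewrite E ler_norml /lo => /andP[]; lra.
have up_homo : {homo up : i j / (i <= j)%N >-> j <= i}.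
  apply: homo_leq => [|y x z xy yz|k]; [exact: lexx|exact: le_trans yz xy|].
  by have := du k; rewrite E ler_norml /up => /andP[]; lra.
have lo_le_up i j : lo i <= up j.
  have := lo_homo _ _ (leq_maxl i j); have := up_homo _ _ (leq_maxr i j).
  have : 0 <= c * q ^+ maxn i j by rewrite mulr_ge0// exprn_ge0.
  rewrite /lo /up; lra.
exists (sup (range lo)) => k; rewrite ler_norml.
have : lo k <= sup (range lo).
  by apply: ub_le_sup; [exists (up 0%N) => _ [i _ <-]; exact: lo_le_up|exists k].
have : sup (range lo) <= up k.
  by apply: ge_sup; [exists (lo 0%N); exists 0%N|move=> _ [i _ <-]; exact: lo_le_up].
by rewrite /lo /up => ? ?; apply/andP; split; lra.
Qed.

(** The set of all a with this property is bounded by c and stable under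
division by q, so its supremum s satisfies s / q <= s, which forces s <= 0. *)
Lemma le0_geometric (a c q : R) : 0 < q < 1 ->
  (forall k, a <= c * q ^+ k) -> a <= 0.
Proof.
move=> /andP[q0 q1] ac.
pose S := [set a : R | forall k, a <= c * q ^+ k]%classic.
have ubS : has_ubound S by exists c => x /(_ 0%N); rewrite expr0 mulr1.
have sS : S (sup S).
  by move=> k; apply: ge_sup; [exists a | move=> x /(_ k)].
have : sup S / q <= sup S.
  apply: ub_le_sup => // k; rewrite ler_pdivrMr// -mulrA -exprSr; exact: sS.
rewrite ler_pdivrMr// => s0; have : a <= sup S by exact: ub_le_sup.
nra.
Qed.

End Geometric.

(** * Contractions for the Euclidean norm *)

Section Contraction.
Context {R : realType} {n : nat}.
Context (G : 'cV[R]_n -> 'cV[R]_n) (q : R).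
Context (q01 : 0 < q < 1).
Context (Gq : forall y z, norm2 (G y - G z) <= q * norm2 (y - z)).

Lemma norm2_iter_contraction y z k :
  norm2 (iter k G y - iter k G z) <= q ^+ k * norm2 (y - z).
Proof.
case/andP: q01 => q0 _; elim: k => [|k IH]; first by rewrite expr0 mul1r.
by rewrite !iterS (le_trans (Gq _ _))// exprS -mulrA ler_wpM2l// ltW.
Qed.

Lemma contraction_fixpoint_unique y z : G y = y -> G z = z -> y = z.
Proof.
move=> Gy Gz; apply/eqP; rewrite -subr_eq0; apply/eqP/norm2_le0_eq0.
have /andP[_ q1] := q01; have := Gq y z.
by rewrite Gy Gz -subr_le0 -{1}[norm2 _]mul1r -mulrBl pmulr_rle0 ?subr_gt0.
Qed.

(** The orbit of 0 converges coordinatewise to some y, at a geometric rate.  By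
continuity of G both terms of |G y - G (u k)| + |u (k+1) - y| decay
geometrically, while their sum bounds the constant |G y - y|. *)
Lemma contraction_fixpoint_exists : exists y, G y = y.
Proof.
have /andP[q0 q1] := q01.
pose u k := iter k G 0; pose c := norm2 (G 0 - 0) / (1 - q).
have c0 : 0 <= c by rewrite divr_ge0 ?norm2_ge0// subr_ge0 ltW.
(* c is the sum of the geometric series of increments, so c (1 - q) = |G 0|. *)
have /boolp.choice[l ul] : forall i, exists l, forall k, `|u k i 0 - l| <= c * q ^+ k.
  move=> i; apply: (@geometric_increments_limit _ (fun k => u k i 0)) => //; last exact: ltW.
  move=> k; rewrite /c divfK ?subr_eq0 ?gt_eqF//.
  have := norm_coord_le_norm2 _ (u k.+1 - u k) i; rewrite !mxE => /le_trans; apply.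
  by rewrite /u iterSr mulrC norm2_iter_contraction.
pose y : 'cV[R]_n := \col_i l i; exists y.
have uy k : norm2 (u k - y) <= n%:R * (c * q ^+ k).
  by apply: norm2_le_card => i; rewrite !mxE.
apply/eqP; rewrite -subr_eq0; apply/eqP/norm2_le0_eq0.
apply: (@le0_geometric _ _ (2 * n%:R * c * q) q) => // k.
have -> : G y - y = (G y - G (u k)) + (u k.+1 - y) by rewrite addrA subrK.
apply: le_trans (norm2D _ _ _) _.
have := uy k.+1; have := Gq y (u k); rewrite [norm2 (y - u k)]norm2_dist exprS.
have := uy k; rewrite -(ler_pM2l q0); lra.
Qed.

End Contraction.

(** * The absolute value equation and the relaxed iteration *)

Lemma ave_solutionE (R : realType) n (A : 'M[R]_n) b x : A \in unitmx ->
  ave_solution A b x <-> x = invmx A *m (vabs x + b).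
Proof.
move=> hA; rewrite /ave_solution; split.
  by move=> <-; rewrite addrC subrK mulKmx.
by move=> {1}->; rewrite mulKVmx// addrAC subrr add0r.
Qed.

Definition fpi_map {R : realType} {n} (A : 'M[R]_n) (b : 'cV[R]_n) (tau : R) y :=
  (1 - tau) *: y + tau *: vabs (invmx A *m (y + b)).

Lemma fpi_map_contraction (R : realType) n (A : 'M[R]_n) b (tau : R) y z :
  0 <= tau ->
  norm2 (fpi_map A b tau y - fpi_map A b tau z)
    <= (`|1 - tau| + tau * opnorm2 (invmx A)) * norm2 (y - z).
Proof.
move=> t0; rewrite /fpi_map opprD addrACA -!scalerBr.
apply: le_trans (norm2D _ _ _) _.
rewrite !norm2Z (ger0_norm t0) mulrDl lerD2l -mulrA ler_wpM2l//.
apply: le_trans (norm2_vabs_dist _ _ _) _.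
by rewrite -mulmxBr opprD addrACA subrr addr0 norm2_mulmx_le_opnorm2.
Qed.

(** Relaxation averages y with its image, with weight tau on the image; as
tau <> 0 this moves no fixed point and creates none. *)
Lemma fpi_map_fixpointE (R : realType) n (A : 'M[R]_n) b (tau : R) y :
  0 < tau -> fpi_map A b tau y = y <-> vabs (invmx A *m (y + b)) = y.
Proof.
move=> t0; rewrite /fpi_map; split=> [|->]; last first.
  by rewrite -scalerDl subrK scale1r.
rewrite scalerBl scale1r -addrA => /(canRL (addKr _)); rewrite addNr addrC.
move/eqP; rewrite subr_eq0 => /eqP; apply: scalerI; exact: lt0r_neq0.
Qed.

Lemma fpi_snd (R : realType) n (A : 'M[R]_n) b tau x0 y0 k :
  (fpi A b tau x0 y0 k).2 = iter k (fpi_map A b tau) y0.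
Proof. by rewrite /fpi; elim: k => //= k ->. Qed.

Lemma relaxed_rate_lt1 (R : realType) (nu tau : R) :
  0 < nu < 1 -> 0 < tau < 2 / (nu + 1) -> 0 < `|1 - tau| + tau * nu < 1.
Proof.
move=> /andP[nu0 nu1] /andP[t0]; rewrite ltr_pdivlMr; last lra.
move=> t2; apply/andP; split.
  by apply: ltr_wpDl => //; exact: mulr_gt0.
by have [h|h] := leP 0 (1 - tau); [rewrite ger0_norm//|rewrite ltr0_norm//]; nra.
Qed.

Theorem theorem4p1 (R : realType) (n : nat) (A : 'M[R]_n) (nu tau : R)
    (hA : A \in unitmx) (hnu : nu = opnorm2 (invmx A))
    (hnu01 : 0 < nu < 1) (htau : 0 < tau < 2 / (nu + 1)) (b : 'cV[R]_n) :
  exists xs : 'cV[R]_n,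
    unique (ave_solution A b) xs /\
    forall x0 y0 : 'cV[R]_n,
      converges_linearly (fpi A b tau x0 y0) xs (vabs xs).
Proof.
have q01 := relaxed_rate_lt1 _ _ _ hnu01 htau.
have [/andP[nu0 _] /andP[t0 _]] := (hnu01, htau).
set q := `|1 - tau| + tau * nu in q01; have /andP[q0 q1] := q01.
set G := fpi_map A b tau.
have Gq y z : norm2 (G y - G z) <= q * norm2 (y - z).
  by rewrite /q hnu fpi_map_contraction// ltW.
have [ys Gys] := contraction_fixpoint_exists _ _ q01 Gq.
pose xs := invmx A *m (ys + b).
have vxs : vabs xs = ys by exact/(fpi_map_fixpointE _ _ _ _ _ _ t0).
exists xs; split; first split.
- by apply/ave_solutionE; rewrite // vxs.
- move=> x /(ave_solutionE _ _ _ _ _ hA) xE.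
  suff yE : ys = vabs x by rewrite xE -yE.
  apply: (contraction_fixpoint_unique _ _ q01 Gq) => //.
  by apply/fpi_map_fixpointE => //; rewrite -xE.
move=> x0 y0; rewrite vxs.
set D := norm2 (y0 - ys); have D0 : 0 <= D := norm2_ge0 _ _.
have yk k : norm2 ((fpi A b tau x0 y0 k).2 - ys) <= q ^+ k * D.
  have ysk : ys = iter k G ys by elim: k => //= k <-.
  by rewrite fpi_snd {1}ysk norm2_iter_contraction.
set E := norm2 (x0 - xs); have E0 : 0 <= E := norm2_ge0 _ _.
have nq0 : 0 <= nu / q * D by rewrite mulr_ge0// divr_ge0// ltW.
(* The first component at k+1 is within nu q^k D = (nu / q) D q^(k+1) of xs;
   at k = 0 it is the arbitrary x0, whose error E has to be added. *)
exists (E + nu / q * D + D), q; split=> //; first by rewrite !addr_ge0.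
move=> k; have qk0 : 0 <= q ^+ k by rewrite exprn_ge0// ltW.
split; last by apply: le_trans (yk k) _; rewrite mulrC ler_wpM2r// lerDr addr_ge0.
case: k qk0 => [|k] qk0; first by rewrite expr0 mulr1 -/E -addrA lerDl addr_ge0.
rewrite [(fpi _ _ _ _ _ _).1]/= -mulmxBr opprD addrACA subrr addr0.
apply: le_trans (norm2_mulmx_le_opnorm2 _ _ _ _) _; rewrite -hnu.
apply: (@le_trans _ _ (nu / q * D * q ^+ k.+1)).
  rewrite (_ : _ * q ^+ k.+1 = nu * (q ^+ k * D)).
    by rewrite ler_pM2l//; exact: yk.
  by rewrite exprS; field; rewrite gt_eqF.
by rewrite ler_wpM2r//; lra.
Qed.
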